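(* Let $f$ be an element of $V$. Then there is an $n(f)\in\mathbf{N}$ so that any finite orbit of $f$ (acting on the Cantor set) has no more than $n(f)$ elements.
   Context: $V$ is Thompson's group $V$, acting on the Cantor set $C$, whose points are identified with infinite words in the alphabet $\{0,1\}$. Let $T$ be the set of finite words on $\{0,1\}$, viewed as the infinite binary tree in which $v0$ and $v1$ are the children of $v$ and the empty word is the root. A finite tree is a nonempty finite subset $D$ of $T$ such that every prefix of a node in $D$ is in $D$, and $v0\in D$ if and only if $v1\in D$; its leaves are the nodes of $D$ whose children are not in $D$. A triple $(D,\sigma,R)$, where $D$ and $R$ are finite trees with the same number of leaves and $\sigma$ is a bijection from the leaves of $D$ to the leaves of $R$, represents the self homeomorphism of $C$ that sends $uz$ to $\sigma(u)z$ for every leaf $u$ of $D$ and every infinite word $z$. The group $V$ consists of all homeomorphisms so represented. An orbit of $f$ is an orbit of the action on $C$ of the cyclic group generated by $f$. *)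

(* Defs.v *)
From mathcomp Require Import all_boot all_algebra finmap.
From mathcomp Require Import boolp classical_sets functions cardinality.
From mathcomp Require Import topology cantor.

Set Implicit Arguments.
Unset Strict Implicit.
Unset Printing Implicit Defensive.

Local Open Scope fset_scope.
Local Open Scope classical_set_scope.

Record homeo (X : topologicalType) := Homeo {
  hfun :> X -> X;
  hinv : X -> X;
  hfunK : cancel hfun hinv;
  hinvK : cancel hinv hfun;
  hfun_cont : continuous hfun;
  hinv_cont : continuous hinv }.

(* [Negz n] is the integer -(n+1). *)
Definition homeo_pow (X : topologicalType) (f : homeo X) (k : int) : X -> X :=
  match k with
  | Posz n => iter n (hfun f)
  | Negz n => iter n.+1 (hinv f)
  end.

Definition cyclic_orbit (X : topologicalType) (f : homeo X) (x : X) : set X :=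
  [set homeo_pow f k x | k in [set: int]].

(* The letters 0 and 1 are [false] and [true]. *)
Definition word := seq bool.

Record finite_tree := FiniteTree {
  nodes :> {fset word};
  nodes_neq0 : nodes != fset0;
  nodes_prefix : forall u v : word, prefix u v -> v \in nodes -> u \in nodes;
  nodes_children : forall v : word,
    (rcons v false \in nodes) = (rcons v true \in nodes) }.

Definition leaves (D : finite_tree) : {fset word} :=
  [fset v in nodes D |
    (rcons v false \notin nodes D) && (rcons v true \notin nodes D)].

(* Equality of the numbers of leaves is a consequence of [leaf_map_bij]. *)
Record tree_triple := TreeTriple {
  dom_tree : finite_tree;
  ran_tree : finite_tree;
  leaf_map : leaves dom_tree -> leaves ran_tree;
  leaf_map_bij : bijective leaf_map }.

Definition concat (u : word) (z : cantor_space) : cantor_space :=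
  fun n => if n < size u then nth false u n else z (n - size u).

Definition represents (t : tree_triple) (f : homeo cantor_space) : Prop :=
  forall (u : leaves (dom_tree t)) (z : cantor_space),
    f (concat (val u) z) = concat (val (leaf_map u)) z.

Definition thompsonV : set (homeo cantor_space) :=
  [set f | exists t : tree_triple, represents t f].

(* Main.v *)
Require Import Defs.
From mathcomp Require Import all_boot all_algebra finmap.
From mathcomp Require Import boolp classical_sets functions cardinality.
From mathcomp Require Import topology cantor.
From mathcomp Require Import order zify.

Set Implicit Arguments.
Unset Strict Implicit.
Unset Printing Implicit Defensive.

Import GRing.Theory Num.Theory Order.TTheory.

Local Open Scope classical_set_scope.
Local Open Scope card_scope.


(** An element [f] of V replaces a prefix of bounded length, at most [M], of
each infinite word by another prefix. Suppose that the orbit of [x] has [p]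
points, and follow the length of the replaced part along it: each application
of [f] changes this length by an integer, and the sum of these changes over the
period is the total height. Replacing [f] by its inverse negates the total
height, so it may be taken nonnegative.

Then some point [y] of the orbit is lowest: the partial sums that start from
[y] never become negative ([exists_lowest_point]). Write [y = s z] with [s] of
length [M]. As the height never drops below its starting value, the iterates of
[f] at [y] never read a letter of [z], so that [f^j (s z') = s_j z'] for every
infinite word [z'] ([iter_on_cone]). The evolution of [y] depends only on [s].

The word [s] even determines the period. If [y = s z] is fixed by [f^p], then
[f^p (s z') = s t z'] for a fixed word [t]. When [t] is empty, [f^p] fixes
every point of the cone of [s]; otherwise [f^p] contracts this cone, which then
contains a single periodic point. In both cases every periodic point of the
cone is fixed by [f^p] ([cone_common_period]).

There are finitely many words of length [M], so the product of the periods
attached to them, for [f] and for its inverse, is a common period of all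
periodic points, and it bounds the size of every finite orbit. *)

(** * Periods of iterated maps *)

Lemma iter_fixed_mul (T : Type) (f : T -> T) (m n : nat) (x : T) :
  iter m f x = x -> iter (n * m) f x = x.
Proof. by move=> fx; elim: n => // n IHn; rewrite mulSn iterD IHn. Qed.

Lemma iter_fixed_modn (T : Type) (f : T -> T) (m k : nat) (x : T) :
  iter m f x = x -> iter k f x = iter (k %% m) f x.
Proof.
by move=> fx; rewrite {1}(divn_eq k m) addnC iterD iter_fixed_mul.
Qed.

Lemma iter_canK (T : Type) (f g : T -> T) (n : nat) :
  cancel f g -> cancel (iter n f) (iter n g).
Proof. by move=> fK; elim: n => // n IHn x; rewrite iterSr /= fK IHn. Qed.

Lemma iter_fixed_can (T : Type) (f g : T -> T) (n : nat) (x : T) :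
  cancel f g -> iter n f x = x -> iter n g x = x.
Proof. by move=> fK fx; rewrite -{1}fx (iter_canK n fK). Qed.

Lemma iter_fixed_shift (T : Type) (f : T -> T) (p i N : nat) (x : T) :
  i <= p -> iter p f x = x -> iter N f (iter i f x) = iter i f x ->
  iter N f x = x.
Proof.
move=> le_ip fx fy; have xE : x = iter (p - i) f (iter i f x).
  by rewrite -iterD subnK.
by rewrite {1}xE -iterD addnC iterD fy -xE.
Qed.

Lemma finite_cyclic_orbit_periodic (X : topologicalType) (f : homeo X) (x : X) :
  finite_set (cyclic_orbit f x) -> exists2 p, 0 < p & iter p f x = x.
Proof.
move=> finO; apply: contrapT => noper; apply: infinite_nat.
have memO n : cyclic_orbit f x (iter n f x) by exists (Posz n).
have -> : [set: nat] = (fun n => iter n f x) @^-1` cyclic_orbit f x.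
  by apply/seteqP; split=> // n _; apply: memO.
have lt_neq i j : i < j -> iter i f x <> iter j f x.
  move=> lt_ij eq_ij; apply: noper; exists (j - i); first by rewrite subn_gt0.
  rewrite -[RHS](iter_canK i (hfunK f)) eq_ij -[in RHS](subnKC (ltnW lt_ij)).
  by rewrite iterD iter_canK //; apply: hfunK.
apply: finite_preimage finO => i j _ _ /= eq_ij.
by case: (ltngtP i j) => // /lt_neq; rewrite eq_ij.
Qed.

Lemma cyclic_orbit_card_le (X : topologicalType) (f : homeo X) (N : nat) (x : X) :
  0 < N -> iter N f x = x -> cyclic_orbit f x #<= `I_N.
Proof.
move=> N_gt0 fx.
apply: (@card_le_trans _ _ _ [set iter i f x | i in `I_N]); last first.
  exact: card_image_le.
apply: subset_card_le => _ [k _ <-].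
have [m ->] : exists m, homeo_pow f k x = iter m f x.
  case: k => n /=; first by exists n.
  (* Backward iteration is forward iteration from a multiple of the period. *)
  exists (n.+1 * N - n.+1).
  rewrite -[in LHS](iter_fixed_mul n.+1 fx) -{1}(@subnKC n.+1 (n.+1 * N)) ?leq_pmulr //.
  by rewrite iterD -[LHS]/(iter n.+1 _ _) iter_canK //; apply: hfunK.
by exists (m %% N); rewrite /= ?ltn_mod // -iter_fixed_modn.
Qed.

(** * Prefixes of infinite words *)

Lemma concat_cat (u v : word) (z : cantor_space) :
  concat (u ++ v) z = concat u (concat v z).
Proof.
apply/funext => n; rewrite /concat size_cat nth_cat.
have [lt_nu|le_un] := ltnP n (size u); first by rewrite ltn_addr.
by rewrite ltn_subLR // subnDA.
Qed.

Lemma concat_inj (u : word) : injective (concat u).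
Proof.
move=> a b eq_ab; apply/funext => n.
have /(congr1 (@^~ (size u + n))) := eq_ab.
by rewrite /concat ltnNge leq_addr /= addKn.
Qed.

Lemma concat_eq_cat (u w : word) (a b : cantor_space) :
  concat u a = concat w b -> size u <= size w -> exists r, w = u ++ r.
Proof.
move=> eq_uw le_uw; exists (drop (size u) w).
rewrite -[LHS](cat_take_drop (size u)); congr (_ ++ _).
apply: (@eq_from_nth _ false) => [|n]; rewrite size_takel // => lt_nu.
have := congr1 (@^~ n) eq_uw.
by rewrite /concat lt_nu (leq_trans lt_nu le_uw) nth_take.
Qed.

Lemma concat_mkseq (x : cantor_space) (n : nat) :
  x = concat (mkseq x n) (fun i => x (n + i)).
Proof.
apply/funext => i; rewrite /concat size_mkseq.
by case: ltnP => [lt_in|le_ni]; rewrite ?nth_mkseq ?subnKC.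
Qed.

Lemma iter_concat_agree (t : word) (a b : cantor_space) (k n : nat) :
  t != [::] -> n < k -> iter k (concat t) a n = iter k (concat t) b n.
Proof.
move=> t_neq0; have t_gt0 : 0 < size t by case: t t_neq0.
elim: k n => // k IHk n lt_nk /=.
rewrite /concat; case: ltnP => // le_tn; apply: IHk; lia.
Qed.

(** Prepending a nonempty word is a contraction of the Cantor set, so all its
periodic points coincide with its fixed point. *)
Lemma concat_fixed_unique (t : word) (a b : cantor_space) (q : nat) :
  t != [::] -> 0 < q -> concat t a = a -> iter q (concat t) b = b -> a = b.
Proof.
move=> t_neq0 q_gt0 ta tb; apply/funext => n.
(* Enough iterations of [concat t] make letter [n] independent of the tail. *)
rewrite -(@iter_fixed_mul _ (concat t) 1 (n.+1 * q) a) // muln1.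
rewrite -[in RHS](iter_fixed_mul n.+1 tb).
by apply: iter_concat_agree => //; rewrite leq_pmulr.
Qed.

(** * Maps that replace bounded prefixes *)

(** The function [c] records the change of length. The map [f] determines it,
but a name for it lets the changes for a map and for its inverse be
compared. *)
Definition prefix_replacing (M : nat) (f : cantor_space -> cantor_space)
    (c : cantor_space -> int) : Prop :=
  forall x, exists u v z, [/\ size u <= M, x = concat u z,
    forall z', f (concat u z') = concat v z' &
    c x = ((size v)%:Z - (size u)%:Z)%R].

Definition height (f : cantor_space -> cantor_space) (c : cantor_space -> int)
    (x : cantor_space) (j : nat) : int :=
  (\sum_(i < j) c (iter i f x))%R.

Lemma heightD f c x i j :
  height f c x (i + j) = (height f c x i + height f c (iter i f x) j)%R.
Proof.
rewrite /height big_split_ord /=; congr (_ + _)%R.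
by apply: eq_bigr => k _; rewrite addnC iterD.
Qed.

Lemma height_mul f c x p q :
  iter p f x = x -> height f c x (q * p) = (height f c x p *+ q)%R.
Proof.
move=> fx; elim: q => [|q IHq]; first by rewrite /height big_ord0.
by rewrite mulSn heightD fx IHq mulrS.
Qed.

(** Since the height over a full period is nonnegative, the minimum over one
period is the minimum over all times. *)
Lemma exists_lowest_point f c x p :
  0 < p -> iter p f x = x -> (0 <= height f c x p)%R ->
  exists2 i, i < p & forall j, (0 <= height f c (iter i f x) j)%R.
Proof.
move=> p_gt0 fx hp_ge0; pose i0 := Ordinal p_gt0.
have [i _ le_i] := arg_minP (fun i : 'I_p => height f c x i) (erefl (predT i0)).
exists i => // j.
have : (height f c x i <= height f c x (i + j))%R.
  rewrite (divn_eq (i + j) p) heightD iter_fixed_mul // height_mul //.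
  apply: le_trans (le_i (Ordinal (ltn_pmod (i + j) p_gt0)) isT) _.
  by rewrite lerDr mulrn_wge0.
by rewrite heightD lerDl.
Qed.

(** As long as the height is nonnegative, the current word [w] is at least as
long as any prefix that the map inspects, so the tail is carried along
unread. *)
Lemma iter_on_cone M f c s z :
  prefix_replacing M f c -> M <= size s ->
  (forall j, 0 <= height f c (concat s z) j)%R ->
  forall j, exists2 w, ((size w)%:Z = (size s)%:Z + height f c (concat s z) j)%R
    & forall z', iter j f (concat s z') = concat w z'.
Proof.
move=> fM leMs h_ge0; elim=> [|j [w szw fw]].
  by exists s => //; rewrite /height big_ord0 addr0.
have [u [v [z2 [leuM xE fu cE]]]] := fM (iter j f (concat s z)).
have leuw : size u <= size w by have := h_ge0 j; lia.
move: xE; rewrite fw => /esym /concat_eq_cat /(_ leuw) [r wE].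
exists (v ++ r); last by move=> z'; rewrite /= fw wE !concat_cat fu.
rewrite /height big_ord_recr /= -/(height _ _ _ _) cE.
by move: szw; rewrite wE !size_cat; lia.
Qed.

(** Only [s a] is required to be a lowest point of its orbit: the action of
[iter p f] on the cone of [s] is already determined by it. It is the operation
of inserting a word [t] after [s], which either fixes the cone pointwise or
has [s a] as its only periodic point there. *)
Lemma cone_common_period M f c s a b p q :
  prefix_replacing M f c -> M <= size s ->
  (forall j, 0 <= height f c (concat s a) j)%R ->
  iter p f (concat s a) = concat s a ->
  0 < q -> iter q f (concat s b) = concat s b ->
  iter p f (concat s b) = concat s b.
Proof.
move=> fM leMs h_ge0 fa q_gt0 fb.
have [w szw fw] := iter_on_cone fM leMs h_ge0 p.
have lesw : size s <= size w by have := h_ge0 p; lia.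
move: (fa); rewrite fw => /esym /concat_eq_cat /(_ lesw) [t wE].
have ft z : iter p f (concat s z) = concat s (concat t z).
  by rewrite fw wE concat_cat.
have [t0|t_neq0] := eqVneq t [::].
  by rewrite ft t0 -concat_cat cats0.
have ftn n z : iter (n * p) f (concat s z) = concat s (iter n (concat t) z).
  by elim: n => // n IHn; rewrite mulSn iterD IHn ft.
have ta : concat t a = a by apply: (@concat_inj s); rewrite -ft.
have tb : iter q (concat t) b = b.
  by apply: (@concat_inj s); rewrite -ftn mulnC iter_fixed_mul.
by rewrite -(concat_fixed_unique t_neq0 q_gt0 ta tb).
Qed.

(** Each of the finitely many words of length [M] contributes one period,
which serves every lowest point having this word as a prefix. A period of a
lowest point is a period of its whole orbit. *)
Lemma nonneg_height_period M f c :
  prefix_replacing M f c ->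
  exists2 N, 0 < N & forall x p, 0 < p -> iter p f x = x ->
    (0 <= height f c x p)%R -> iter N f x = x.
Proof.
move=> fM.
have per_cone (s : M.-tuple bool) : exists n, 0 < n /\
    forall a q, 0 < q -> iter q f (concat s a) = concat s a ->
    (forall j, 0 <= height f c (concat s a) j)%R ->
    iter n f (concat s a) = concat s a.
  have [[a [p [p_gt0 fa h_ge0]]]|none] := pselect (exists a p,
    [/\ 0 < p, iter p f (concat s a) = concat s a &
        forall j, (0 <= height f c (concat s a) j)%R]).
    (* A periodic lowest point in the cone of [s] fixes the period of all. *)
    exists p; split=> // b q q_gt0 fb _.
    by apply: cone_common_period fM _ h_ge0 fa q_gt0 fb; rewrite size_tuple.
  by exists 1; split=> // a q q_gt0 fa h_ge0; case: none; exists a, q.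
have [n nP] := choice per_cone.
exists (\prod_s n s) => [|x p p_gt0 fx hp_ge0].
  by apply: prodn_gt0 => s; have [] := nP s.
have [i lt_ip h_ge0] := exists_lowest_point p_gt0 fx hp_ge0.
apply: (iter_fixed_shift (ltnW lt_ip) fx).
have fy : iter p f (iter i f x) = iter i f x by rewrite -iterD addnC iterD fx.
move: (iter i f x) fy h_ge0 => y; rewrite (concat_mkseq y M).
set z := (fun i => _); have szs : size (mkseq y M) == M by rewrite size_mkseq.
rewrite -[mkseq y M]/(tval (Tuple szs)) => fy h_ge0.
rewrite (bigD1 (Tuple szs)) //= mulnC; apply: iter_fixed_mul.
by have [_] := nP (Tuple szs); apply; eassumption.
Qed.

(** The orbit under the inverse is the same cycle traversed backwards, with
each change of length negated. *)
Lemma height_inverse f g c x p :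
  cancel f g -> iter p f x = x ->
  height g (fun y => - c (g y))%R x p = (- height f c x p)%R.
Proof.
move=> fK fx; rewrite /height sumrN; congr (- _)%R.
rewrite [RHS](reindex_inj rev_ord_inj); apply: eq_bigr => i _ /=; congr c.
rewrite -iterS -{1}fx.
have -> : iter p f x = iter i.+1 f (iter (p - i.+1) f x).
  by rewrite -iterD subnKC.
by rewrite (iter_canK i.+1 fK).
Qed.

(** * Elements of Thompson's group *)

(** The longest prefix of [x] that is a node is a leaf: its child along [x] is
not a node, hence neither is its other child. *)
Lemma leaves_cover (D : finite_tree) (x : cantor_space) :
  exists (u : leaves D) z, x = concat (val u) z.
Proof.
pose P n := mkseq x n \in nodes D.
have P0 : exists n, P n.
  exists 0; have /fset0Pn [v vD] := nodes_neq0 D.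
  by apply: nodes_prefix vD; apply: prefix0s.
have Pmax n : P n -> n <= \max_(v : nodes D) size (val v).
  move=> Pn; rewrite -{1}(size_mkseq x n).
  exact: (@leq_bigmax _ (fun v : nodes D => size (val v)) [` Pn]%fset).
case: (ex_maxnP P0 Pmax) => n Pn maxn.
have nP : rcons (mkseq x n) (x n) \notin nodes D.
  by apply/negP; rewrite -mkseqS => /maxn; rewrite ltnn.
have uL : mkseq x n \in leaves D.
  rewrite !inE; apply/andP; split; first exact: Pn.
  rewrite -nodes_children andbb; move: nP.
  by case: (x n); rewrite // -nodes_children.
by exists [` uL]%fset, (fun i => x (n + i)); apply: concat_mkseq.
Qed.

(** The inverse replaces the same prefixes in the opposite direction, so one
choice of leaf for each point serves both maps and yields opposite changes of
length; this is what [height_inverse] requires. *)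
Lemma thompsonV_prefix_replacing (f : homeo cantor_space) :
  thompsonV f -> exists M c, prefix_replacing M f c /\
    prefix_replacing M (hinv f) (fun y => - c (hinv f y))%R.
Proof.
move=> [t ft].
have [U UP] := choice (leaves_cover (dom_tree t)).
pose V u := val (@leaf_map t u).
exists (\max_u maxn (size (val u)) (size (V u))).
exists (fun x => (size (V (U x)))%:Z - (size (val (U x)))%:Z)%R.
have leM u : maxn (size (val u)) (size (V u)) <= \max_u maxn (size (val u)) (size (V u)).
  exact: (@leq_bigmax _ (fun u => maxn (size (val u)) (size (V u)))).
split=> [x|y].
  have [z xE] := UP x; exists (val (U x)), (V (U x)), z; split=> //.
  by apply: leq_trans (leM (U x)); apply: leq_maxl.
have [z xE] := UP (hinv f y); exists (V (U (hinv f y))), (val (U (hinv f y))), z.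
split; last by rewrite opprB.
- by apply: leq_trans (leM (U (hinv f y))); apply: leq_maxr.
- by rewrite -[LHS](hinvK f) {1}xE ft.
- by move=> z'; rewrite -ft hfunK.
Qed.

Theorem proposition10p1 (f : homeo cantor_space) (hf : thompsonV f) :
  exists n : nat, forall x : cantor_space,
    finite_set (cyclic_orbit f x) -> cyclic_orbit f x #<= `I_n.
Proof.
have [M [c [fM gM]]] := thompsonV_prefix_replacing hf.
have [N1 N1_gt0 perf] := nonneg_height_period fM.
have [N2 N2_gt0 perg] := nonneg_height_period gM.
exists (N1 * N2) => x /finite_cyclic_orbit_periodic [p p_gt0 fx].
apply: cyclic_orbit_card_le; first by rewrite muln_gt0 N1_gt0.
have [h_ge0|h_lt0] := lerP 0%R (height f c x p).
  by rewrite mulnC; apply: iter_fixed_mul; apply: perf fx h_ge0.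
apply: iter_fixed_mul; apply: iter_fixed_can (hinvK f) _.
apply: (perg x p) => //; first exact: iter_fixed_can (hfunK f) fx.
by rewrite (height_inverse c (hfunK f) fx) oppr_ge0 ltW.
Qed.
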